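(* Let $g:\mathbb R_+\to\mathbb R_+$ be continuous and piecewise linear, let $\mathcal S=\{(k_{tj},C_{tj})\in\mathbb R_+^2: t\in\{1,\dots,n\},\ j\in\{1,\dots,U(t)\}\}$, let $t^*\in\{1,\dots,n\}$ and $L>0$. Let $X_1,\dots,X_{t^*}$ be a nonnegative Markov martingale with support in $[0,L]$. Then there exists a martingale $\tilde X_1,\dots,\tilde X_{t^*}$ with support in $\mathcal K$ such that $$E[(X_t-k_{tj})^+]=E[(\tilde X_t-k_{tj})^+],\quad t=1,\dots,t^*,\ j=1,\dots,U(t),$$ $$E[(X_{t^*}-k_{fut,j})^+]=E[(\tilde X_{t^*}-k_{fut,j})^+],\quad j=1,\dots,U(fut),$$ and $E[g(X_{t^*})]=E[g(\tilde X_{t^*})]$.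
   Context: A Markov martingale is a stochastic process that is both a martingale and a Markov process. Let $\mathcal S_{\ge t^*}=\{(k_{tj},C_{tj})\in\mathcal S: t\ge t^*\}$ and $\mathcal S^\infty_{\ge t^*}=\mathcal S_{\ge t^*}\cup\{(0,+\infty),(+\infty,0)\}$ (points at infinity in the vertical direction above abscissa $0$ and horizontal direction along ordinate $0$). Let $\mathcal F=\{(k_{tj},C_{tj}): t^*<t\le n,\ (k_{tj},C_{tj})\text{ is a vertex of the convex hull of }\mathcal S^\infty_{\ge t^*}\}$, enumerated as $(k_{fut,j},C_{fut,j})$, $j=1,\dots,U(fut)$. Let $\mathcal K_S=\{0\}\cup\{L\}\cup\{k_{tj}: (k_{tj},C_{tj})\in\mathcal S,\ t\le t^*\}\cup\{k_{tj}:(k_{tj},C_{tj})\in\mathcal F\}$, $\mathcal K_g=\{k\in[0,L]: g'(k-)\ne g'(k+)\}$ (points where $g$ changes slope), and $\mathcal K=\mathcal K_S\cup\mathcal K_g$. *)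

(* Defs.v *)
From HB Require Import structures.
From mathcomp Require Import all_boot all_order all_algebra.
From mathcomp Require Import all_classical all_reals all_analysis.
Set Implicit Arguments.
Unset Strict Implicit.
Unset Printing Implicit Defensive.
Import Order.TTheory GRing.Theory Num.Theory.
Import numFieldNormedType.Exports.
Local Open Scope classical_set_scope.
Local Open Scope ring_scope.

Section Defs.
Context {R : realType}.

Definition nat_filtration {d} {T : measurableType d} (X : nat -> T -> R)
  (t : nat) : set (set T) :=
  <<s [set A | exists s : nat, (1 <= s <= t)%N /\
                 preimage_set_system setT (X s) measurable A] >>.

Definition is_martingale {d} {T : measurableType d} (P : probability T R)
  (X : nat -> T -> R) (tN : nat) : Prop :=
  (forall t, (1 <= t <= tN)%N ->
     measurable_fun setT (X t) /\ P.-integrable setT (EFin \o X t)) /\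
  (forall t, (1 <= t)%N -> (t < tN)%N -> forall A, nat_filtration X t A ->
     (\int[P]_(w in A) (X t.+1 w)%:E = \int[P]_(w in A) (X t w)%:E)%E).

Definition is_markov {d} {T : measurableType d} (P : probability T R)
  (X : nat -> T -> R) (tN : nat) : Prop :=
  forall t, (1 <= t)%N -> (t < tN)%N ->
  forall B : set R, measurable B ->
  exists phi : R -> R, measurable_fun setT phi /\
    forall A, nat_filtration X t A ->
      P (A `&` (X t.+1 @^-1` B)) = (\int[P]_(w in A) (phi (X t w))%:E)%E.

Definition piecewise_linear_Rplus (g : R -> R) : Prop :=
  exists (c : seq R) (a0 a1 : nat -> R),
    (0 < size c)%N /\ c`_0 = 0 /\ sorted <%R c /\
    forall (i : nat) (x : R), (i < size c)%N -> c`_i <= x ->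
      ((i.+1 < size c)%N -> x <= c`_i.+1) -> g x = a1 i * x + a0 i.

Definition right_deriv_is (g : R -> R) (k l : R) : Prop :=
  (fun h => (g (k + h) - g k) / h) @ 0^'+ --> l.
Definition left_deriv_is (g : R -> R) (k l : R) : Prop :=
  (fun h => (g (k - h) - g k) / (- h)) @ 0^'+ --> l.

Definition slope_change_pts (g : R -> R) (L : R) : set R :=
  [set k | 0 <= k <= L /\
     forall l1 l2, left_deriv_is g k l1 -> right_deriv_is g k l2 -> l1 <> l2].

(** Convex hull of S_{>= tstar} together with the points at infinity
    (0,+oo) and (+oo,0): conv(S_{>=tstar}) + R_+^2. *)
Definition hull_inf (n : nat) (U : nat -> nat) (k C : nat -> nat -> R)
  (tstar : nat) : set (R * R) :=
  [set q | exists w : nat -> nat -> R,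
     (forall t j, 0 <= w t j) /\
     \sum_(tstar <= t < n.+1) \sum_(1 <= j < (U t).+1) w t j = 1 /\
     \sum_(tstar <= t < n.+1) \sum_(1 <= j < (U t).+1) w t j * k t j <= q.1 /\
     \sum_(tstar <= t < n.+1) \sum_(1 <= j < (U t).+1) w t j * C t j <= q.2].

Definition is_vertex (H : set (R * R)) (p : R * R) : Prop :=
  H p /\ forall a b, H a -> H b ->
    p = ((a.1 + b.1) / 2, (a.2 + b.2) / 2) -> a = b.

Definition in_F (n : nat) (U : nat -> nat) (k C : nat -> nat -> R)
  (tstar t j : nat) : Prop :=
  (tstar < t <= n)%N /\ (1 <= j <= U t)%N /\
  is_vertex (hull_inf n U k C tstar) (k t j, C t j).

Definition K_set (n : nat) (U : nat -> nat) (k C : nat -> nat -> R)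
  (tstar : nat) (L : R) (g : R -> R) : set R :=
  [set x | x = 0 \/ x = L \/
     (exists t j, (1 <= t <= tstar)%N /\ (1 <= j <= U t)%N /\ x = k t j) \/
     (exists t j, in_F n U k C tstar t j /\ x = k t j) \/
     slope_change_pts g L x].

Definition pos_part (x : R) : R := Num.max x 0.

End Defs.

(* Main.v *)
Require Import Defs.
From HB Require Import structures.
From mathcomp Require Import all_boot all_order all_algebra.
From mathcomp Require Import all_classical all_reals all_analysis.
From mathcomp Require Import measurable_realfun ring lra.
Set Implicit Arguments.
Unset Strict Implicit.
Unset Printing Implicit Defensive.
Import Order.TTheory GRing.Theory Num.Theory.
Import numFieldNormedType.Exports HBNNSimple.
Local Open Scope classical_set_scope.
Local Open Scope ring_scope.

(** Replace each [X t] by its random projection onto the two neighbouring points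
    of a finite grid inside K, keeping conditional means.  This changes the
    expectation of no function that is affine between grid points, in particular
    of no call with strike on the grid and not of [g].  Consecutive projected
    laws are coupled as a martingale cell by cell: given that [X t] lies in the
    cell [a, b], its projection lives on {a, b}, that of [X t.+1] lives on grid
    points outside ]a, b[ and has the same barycenter, and the latter law splits
    into two parts with barycenters [a] and [b] by solving a 2x2 linear system.
    Chaining these couplings gives a finite Markov chain. *)

(** * Couplings on a finite set of nodes *)

(** Give the first part a share [s] of the mass at nodes [<= a] and a share [r] of the mass at nodes
    [>= b]: prescribing its mass and barycenter yields a linear system with determinant [D]. The
    solution lies in [0, 1] because the complementary shares solve the same problem for [beta] and
    [b], so they too have nonnegative numerators. *)
Lemma two_point_split (R : realFieldType) (J : finType) (kap n : J -> R)
    (a b alpha beta : R) :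
  a < b -> (forall y, kap y <= a \/ b <= kap y) -> (forall y, 0 <= n y) ->
  0 <= alpha -> 0 <= beta ->
  \sum_y n y = alpha + beta -> \sum_y n y * kap y = alpha * a + beta * b ->
  exists r0 r1 : J -> R,
    [/\ forall y, 0 <= r0 y, forall y, 0 <= r1 y,
        forall y, r0 y + r1 y = n y,
        \sum_y r0 y = alpha /\ \sum_y r0 y * kap y = alpha * a &
        \sum_y r1 y = beta /\ \sum_y r1 y * kap y = beta * b].
Proof.
move=> ab sep n0 al0 be0 mass mean.
pose pm := \sum_(y | kap y <= a) n y.
pose pp := \sum_(y | ~~ (kap y <= a)) n y.
pose em := \sum_(y | kap y <= a) n y * kap y.
pose ep := \sum_(y | ~~ (kap y <= a)) n y * kap y.
have hp : pm + pp = alpha + beta by rewrite -mass [RHS](bigID (fun y => kap y <= a)).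
have he : em + ep = alpha * a + beta * b.
  by rewrite -mean [RHS](bigID (fun y => kap y <= a)).
have pm0 : 0 <= pm by apply: sumr_ge0.
have pp0 : 0 <= pp by apply: sumr_ge0.
have ema : em <= pm * a.
  by rewrite mulr_suml; apply: ler_sum => y ya; apply: ler_wpM2l.
have epb : pp * b <= ep.
  rewrite mulr_suml; apply: ler_sum => y ya; apply: ler_wpM2l => //.
  by case: (sep y) => // h; rewrite h in ya.
pose D := pm * (ep - pp * a) + pp * (pm * a - em).
have splitP (s r : R) : 0 <= s <= 1 -> 0 <= r <= 1 ->
    s * pm + r * pp = alpha -> s * em + r * ep = alpha * a ->
  exists r0 r1 : J -> R,
    [/\ forall y, 0 <= r0 y, forall y, 0 <= r1 y,
        forall y, r0 y + r1 y = n y,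
        \sum_y r0 y = alpha /\ \sum_y r0 y * kap y = alpha * a &
        \sum_y r1 y = beta /\ \sum_y r1 y * kap y = beta * b].
  move=> /andP[s0 s1] /andP[r_0 r_1] hs hr.
  pose c y := if kap y <= a then s else r.
  have sumc (f : J -> R) : \sum_y c y * f y =
      s * (\sum_(y | kap y <= a) f y) + r * (\sum_(y | ~~ (kap y <= a)) f y).
    rewrite (bigID (fun y => kap y <= a)) /= !mulr_sumr; congr (_ + _).
      by apply: eq_bigr => y; rewrite /c => ->.
    by apply: eq_bigr => y; rewrite /c => /negbTE ->.
  have s_n : \sum_y c y * n y = alpha by rewrite sumc.
  have s_k : \sum_y c y * n y * kap y = alpha * a.
    by under eq_bigr do rewrite -mulrA; rewrite sumc.
  exists (fun y => c y * n y), (fun y => n y - c y * n y); split.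
  - by move=> y; rewrite mulr_ge0// /c; case: ifP.
  - move=> y; rewrite subr_ge0 -[leRHS]mul1r; apply: ler_wpM2r => //.
    by rewrite /c; case: ifP.
  - by move=> y; rewrite addrC subrK.
  - by [].
  - split; first by rewrite sumrB mass s_n; ring.
    under eq_bigr do rewrite mulrBl.
    by rewrite sumrB mean s_k; ring.
(* With no mass on the right the mean is at most [a], which forces [beta = 0]; the first part takes
   everything. *)
have [pp_eq|pp_neq] := eqVneq pp 0.
  have ep_eq : ep = 0.
    apply: big1 => y ya; rewrite -(mul0r (kap y)); congr (_ * _).
    by apply/eqP; move: pp_eq => /eqP; rewrite psumr_eq0// => /allP /(_ y);
       rewrite mem_index_enum ya => /(_ isT).
  have be_eq : beta = 0.
    apply/eqP; rewrite eq_le be0 andbT.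
    have : beta * (b - a) <= 0 by move: hp he ema; rewrite pp_eq ep_eq; nra.
    by rewrite pmulr_lle0// subr_gt0.
  by apply: (splitP 1 1); rewrite ?ler01 ?lexx// !mul1r ?hp ?he be_eq; ring.
have [pm_eq|pm_neq] := eqVneq pm 0.
  have em_eq : em = 0.
    apply: big1 => y ya; rewrite -(mul0r (kap y)); congr (_ * _).
    by apply/eqP; move: pm_eq => /eqP; rewrite psumr_eq0// => /allP /(_ y);
       rewrite mem_index_enum ya => /(_ isT).
  have al_eq : alpha = 0.
    apply/eqP; rewrite eq_le al0 andbT.
    have : alpha * (b - a) <= 0 by move: hp he epb; rewrite pm_eq em_eq; nra.
    by rewrite pmulr_lle0// subr_gt0.
  by apply: (splitP 0 0); rewrite ?ler01 ?lexx// al_eq; ring.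
have pp1 : 0 < pp by rewrite lt_neqAle eq_sym pp_neq.
have pm1 : 0 < pm by rewrite lt_neqAle eq_sym pm_neq.
have ppm : 0 < pp * pm by apply: mulr_gt0.
(* Positive because the barycenters of the two sides are distinct: [em / pm <= a < b <= ep / pp]. *)
have D0 : 0 < D.
  have : 0 < (pp * pm) * (b - a) by apply: mulr_gt0 => //; lra.
  have : 0 <= pp * (pm * a - em) by apply: mulr_ge0 => //; lra.
  have : 0 <= pm * (ep - pp * b) by apply: mulr_ge0 => //; lra.
  rewrite /D; lra.
have Dn0 : D != 0 by rewrite gt_eqF.
have D2 : D = pm * ep - pp * em by rewrite /D; ring.
apply: (splitP (alpha * (ep - pp * a) / D) (alpha * (pm * a - em) / D)).
- rewrite divr_ge0 ?(ltW D0)//=; last by apply: mulr_ge0 => //; nra.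
  rewrite ler_pdivrMr// mul1r.
  (* The second summand is the numerator of [1 - s], the share kept by the second part. *)
  have -> : D = alpha * (ep - pp * a) + beta * (ep - pp * b).
    transitivity ((alpha + beta) * ep - pp * (alpha * a + beta * b)); last by ring.
    by rewrite -hp -he D2; ring.
  rewrite lerDl; apply: mulr_ge0 => //; lra.
- rewrite divr_ge0 ?(ltW D0)//=; last by apply: mulr_ge0 => //; lra.
  rewrite ler_pdivrMr// mul1r.
  have -> : D = alpha * (pm * a - em) + beta * (pm * b - em).
    transitivity (pm * (alpha * a + beta * b) - (alpha + beta) * em); last by ring.
    by rewrite -hp -he D2; ring.
  rewrite lerDl; apply: mulr_ge0 => //; nra.
- rewrite mulrAC [X in _ + X]mulrAC -mulrDl; apply: (mulIf Dn0).
  by rewrite divfK// /D; ring.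
- rewrite mulrAC [X in _ + X]mulrAC -mulrDl; apply: (mulIf Dn0).
  by rewrite divfK// /D; ring.
Qed.

(* Extending the index type by one coordinate per time step keeps every
   earlier event cylindrical, so the martingale identities at earlier times
   are inherited. *)
Lemma finite_martingale_chain (R : realFieldType) (J : finType) (j0 : J)
    (kap : J -> R)
    (m : nat -> J -> R) (q : nat -> J -> J -> R) (N : nat) :
  (forall t j, 0 <= m t j) -> (forall t j y, 0 <= q t j y) ->
  (forall t, (0 < t < N)%N -> forall j, \sum_y q t j y = m t j) ->
  (forall t, (0 < t < N)%N -> forall j,
     \sum_y q t j y * kap y = m t j * kap j) ->
  (forall t, (0 < t < N)%N -> forall y, \sum_j q t j y = m t.+1 y) ->
  forall n, (n < N)%N ->
  exists (I : finType) (w : I -> R) (Y : nat -> I -> J),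
    [/\ forall i, 0 <= w i,
        forall t, (0 < t <= n.+1)%N -> forall f : J -> R,
          \sum_i w i * f (Y t i) = \sum_j m t j * f j &
        forall t, (0 < t < n.+1)%N -> forall A : I -> R,
          (forall i i', (forall s, (0 < s <= t)%N -> Y s i = Y s i') ->
             A i = A i') ->
          \sum_i A i * w i * kap (Y t.+1 i) = \sum_i A i * w i * kap (Y t i)].
Proof.
move=> m0 q0 qm qk qn; elim => [|n IH] nN.
  exists J, (m 1%N), (fun=> id); split => //; by case=> [|[|t]].
have [I [w [Y [w0 wm wA]]]] := IH (ltnW nN).
have tN : (0 < n.+1 < N)%N by [].
(* From the current node [j] the new node [y] is drawn with transition probability [q j y / m j]. If
   [m j = 0] the quotient is 0 by convention; this is harmless, as [w_null] gives paths through such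
   a node weight zero. *)
pose w' (p : I * J) := w p.1 * (q n.+1 (Y n.+1 p.1) p.2 / m n.+1 (Y n.+1 p.1)).
pose Y' t (p : I * J) := if t == n.+2 then p.2 else Y t p.1.
have w_null i : m n.+1 (Y n.+1 i) = 0 -> w i = 0.
  move=> mi0; have := wm n.+1 (ltnSn _) (fun j => (j == Y n.+1 i)%:R).
  rewrite [RHS](bigD1 (Y n.+1 i))//= eqxx mulr1 mi0 add0r.
  rewrite [RHS]big1; last by move=> j /negbTE ->; rewrite mulr0.
  move/eqP; rewrite psumr_eq0; last by move=> k _; rewrite mulr_ge0.
  by move=> /allP /(_ i); rewrite mem_index_enum eqxx mulr1 => /(_ isT)/eqP.
have sum_w' (F : I -> J -> R) : \sum_p w' p * F p.1 p.2 =
    \sum_i w i / m n.+1 (Y n.+1 i) * \sum_y q n.+1 (Y n.+1 i) y * F i y.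
  rewrite -(pair_bigA _ (fun i y => w' (i, y) * F i y)) /=.
  apply: eq_bigr => i _; rewrite mulr_sumr; apply: eq_bigr => y _.
  by rewrite /w' /=; ring.
have sum_w1 (F : I -> R) : \sum_p w' p * F p.1 = \sum_i w i * F i.
  rewrite (sum_w' (fun i _ => F i)); apply: eq_bigr => i _.
  rewrite -mulr_suml qm// mulrA; congr (_ * _).
  have [mi|mi] := eqVneq (m n.+1 (Y n.+1 i)) 0; last by rewrite divfK.
  by rewrite mi w_null// !mul0r.
exists (I * J)%type, w', Y'; split.
- by move=> p; rewrite mulr_ge0// divr_ge0.
- move=> t /andP[t0]; rewrite leq_eqVlt => /orP[/eqP ->|tn] f.
    rewrite /Y' eqxx (sum_w' (fun _ => f)).
    under eq_bigr do rewrite -mulrA.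
    rewrite (wm n.+1 (ltnSn _) (fun j => (m n.+1 j)^-1 * \sum_y q n.+1 j y * f y))//.
    under [RHS]eq_bigr do rewrite -qn// mulr_suml.
    rewrite exchange_big /=; apply: eq_bigr => j _; rewrite mulrA.
    have [mj|mj] := eqVneq (m n.+1 j) 0; last by rewrite mulfV// mul1r.
    rewrite mj mul0r mul0r big1// => y _; rewrite (_ : q _ _ _ = 0) ?mul0r//.
    have /eqP := qm n.+1 tN j; rewrite mj psumr_eq0// => /allP /(_ y).
    by rewrite mem_index_enum => /(_ isT)/eqP.
  have tn' : (t == n.+2) = false by apply: ltn_eqF.
  by rewrite /Y' tn' (sum_w1 (fun i => f (Y t i))) wm// t0.
- move=> t /andP[t0 tn] A cylA.
  (* [A] does not see the new coordinate, so the value [j0] put there is arbitrary. *)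
  pose A0 i := A (i, j0).
  have AE p : A p = A0 p.1.
    apply: cylA => s /andP[s0 st]; rewrite /Y' ltn_eqF//.
    exact: leq_ltn_trans st tn.
  have cylA0 i i' : (forall s, (0 < s <= t)%N -> Y s i = Y s i') -> A0 i = A0 i'.
    move=> h; apply: cylA => s /andP[s0 st]; rewrite /Y' ltn_eqF/=.
      by apply: h; rewrite s0.
    exact: leq_ltn_trans st tn.
  have t_neq : (t == n.+2) = false by apply: ltn_eqF.
  have -> : \sum_p A p * w' p * kap (Y' t p) = \sum_i A0 i * w i * kap (Y t i).
    rewrite (eq_bigr (fun p => w' p * (A0 p.1 * kap (Y t p.1)))).
      rewrite (sum_w1 (fun i => A0 i * kap (Y t i))).
      by apply: eq_bigr => i _; ring.
    by move=> p _; rewrite /Y' t_neq AE; ring.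
  (* Only the new step [t = n.+1] uses the barycenter of [q]; earlier steps come from the induction
     hypothesis. *)
  move: tn; rewrite ltnS leq_eqVlt => /orP[/eqP tE|tn].
    rewrite tE (eq_bigr (fun p => w' p * (A0 p.1 * kap p.2))); last first.
      by move=> p _; rewrite /Y' eqxx AE; ring.
    rewrite (sum_w' (fun i y => A0 i * kap y)); apply: eq_bigr => i _.
    have -> : \sum_y q n.+1 (Y n.+1 i) y * (A0 i * kap y) =
        A0 i * (m n.+1 (Y n.+1 i) * kap (Y n.+1 i)).
      by rewrite -qk// mulr_sumr; apply: eq_bigr => y _; ring.
    have [mi|mi] := eqVneq (m n.+1 (Y n.+1 i)) 0; last by field.
    by rewrite mi w_null//; ring.
  have t1_neq : (t.+1 == n.+2) = false by apply: ltn_eqF.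
  rewrite -wA ?t0//.
  rewrite (eq_bigr (fun p => w' p * (A0 p.1 * kap (Y t.+1 p.1)))).
    rewrite (sum_w1 (fun i => A0 i * kap (Y t.+1 i))).
    by apply: eq_bigr => i _; ring.
  by move=> p _; rewrite /Y' t1_neq AE; ring.
Qed.

(** * Finite probability spaces, filtrations, and changes on null sets *)

Section finite_probability.
Context (R : realType) (I : finType) (w : I -> R).
Hypothesis w_ge0 : forall i, 0 <= w i.
Hypothesis w_sum : \sum_i w i = 1.
Local Open Scope ereal_scope.

(** The finite space is carried to the first [#|I|] integers because on [nat] every set and every
    function is measurable. *)
Definition finite_atom (n : nat) : {measure set nat -> \bar R} :=
  if insub n is Some i then
    mscale (NngNum (w_ge0 (enum_val (i : 'I_#|I|)))) (\d_n)
  else mzero.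

Definition finite_prob := msum finite_atom #|I|.
HB.instance Definition _ := Measure.on finite_prob.

Lemma integral_finite_prob (A : set nat) (f : nat -> R) :
  (forall n, (0 <= f n)%R) ->
  \int[finite_prob]_(n in A) (f n)%:E =
  (\sum_i w i * ((enum_rank i : nat) \in A)%:R * f (enum_rank i))%R%:E.
Proof.
move=> f0.
have mf (D : set nat) (g : nat -> \bar R) : measurable_fun D g by [].
rewrite ge0_integral_measure_sum//.
- rewrite (reindex (@enum_val I I))/=; last by apply: onW_bij; exact: enum_val_bij.
  rewrite -sumEFin; apply: eq_bigr => i _.
  rewrite /finite_atom; case: insubP => [j _ ji|]; last by rewrite ltn_ord.
  have -> : j = i by apply: val_inj.
  rewrite ge0_integral_mscale//=; last by move=> n _; rewrite lee_fin.
  by rewrite integral_dirac// enum_valK diracE/= !EFinM muleA.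
- by move=> n _; rewrite lee_fin.
Qed.

Lemma finite_prob_setT : finite_prob setT = 1.
Proof.
have := @integral_finite_prob setT (fun=> 1%R) (fun=> ler01).
rewrite integral_cst// mul1e => ->; congr EFin; rewrite -[RHS]w_sum.
by apply: eq_bigr => i _; rewrite mem_set// !mulr1.
Qed.

HB.instance Definition _ :=
  Measure_isProbability.Build _ _ _ finite_prob finite_prob_setT.

Definition finite_probability : probability nat R := finite_prob.

End finite_probability.

(** The sets that do not separate [x] from [y] form a sigma-algebra containing the generators of the
    filtration. *)
Lemma nat_filtration_sub (R : realType) (d : measure_display) (T : measurableType d)
    (X : nat -> T -> R) (t : nat) (A : set T) (x y : T) :
  nat_filtration X t A -> (forall s, (1 <= s <= t)%N -> X s x = X s y) ->
  A x -> A y.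
Proof.
move=> FA xy; pose C := [set B : set T | B x <-> B y].
suff : C A by move=> [].
apply: (smallest_sub _ _ FA).
- split => [//|B /= BC|F CF].
    by split=> -[_ nB]; split => // ?; apply: nB; apply/BC.
  by split=> -[n _ ?]; exists n => //; apply/(CF n).
- by move=> B [s [st [E mE <-]]]; rewrite /C/= /preimage/= xy.
Qed.

(* No measurability of [f] is needed: a simple function below [f] can be set
   to [0] on the null set without changing its integral. *)
Lemma ge0_integral_full (R : realType) (d : measure_display) (T : measurableType d)
    (mu : {measure set T -> \bar R}) (D : set T) (f g : T -> \bar R) :
  measurable D -> mu (~` D) = 0%E ->
  (forall x, 0 <= f x)%E -> (forall x, 0 <= g x)%E ->
  (forall x, D x -> f x = g x) ->
  (\int[mu]_x f x = \int[mu]_x g x)%E.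
Proof.
move=> mD muD f0 g0 fg.
suff le (u v : T -> \bar R) : (forall x, 0 <= u x)%E -> (forall x, 0 <= v x)%E ->
    (forall x, D x -> u x = v x) -> (\int[mu]_x u x <= \int[mu]_x v x)%E.
  by apply/eqP; rewrite eq_le !le// => x /fg.
move=> u0 v0 uv; rewrite !ge0_integralTE//.
apply: ge_ereal_sup => _ [h hu <-]; apply: ereal_sup_ubound.
exists (proj_nnsfun h mD).
  move=> x /=; rewrite mindicE; have [xD|xD] := boolP (x \in D).
    by rewrite mulr1 -uv ?hu//; exact: set_mem.
  by rewrite mulr0.
rewrite -!integralT_nnsfun; apply: ge0_ae_eq_integral => //.
- by apply/measurable_EFinP; exact: measurable_funP.
- by apply/measurable_EFinP; exact: measurable_funP.
- by move=> x _; rewrite lee_fin.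
- by move=> x _; rewrite lee_fin.
exists (~` D); split => //; first exact: measurableC.
move=> x; apply: contra_not => Dx _ /=.
by rewrite mindicE mem_set// mulr1.
Qed.

(** Serves to replace [X t] by its truncation inside functions such as [g], which are controlled on
    [0, L] only and may fail to be measurable elsewhere. *)
Lemma integral_full (R : realType) (d : measure_display) (T : measurableType d)
    (mu : {measure set T -> \bar R}) (D : set T) (f g : T -> \bar R) :
  measurable D -> mu (~` D) = 0%E -> (forall x, D x -> f x = g x) ->
  (\int[mu]_x f x = \int[mu]_x g x)%E.
Proof.
move=> mD muD fg; rewrite [LHS]integralE [RHS]integralE; congr (_ - _)%E.
  by apply: (ge0_integral_full mD muD) => // x Dx; rewrite !funepos.unlock fg.
by apply: (ge0_integral_full mD muD) => // x Dx; rewrite !funeneg.unlock fg.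
Qed.

(** * Subdivisions of [0, L] *)

(** Cells are Boolean predicates rather than closed intervals, so that they can be disjoint:
    [cell_sum] says that each point of [0, L] lies in exactly one of them, in the form used to sum
    indicators. By [pos_gap] no node is interior to a cell. *)
Record grid (R : realType) (L : R) := Grid {
  node : finType;
  piece : finType;
  pos : node -> R;
  lo : piece -> node;
  hi : piece -> node;
  cell : piece -> R -> bool;
  lo_lt_hi : forall i, pos (lo i) < pos (hi i);
  pos_gap : forall i j, pos j <= pos (lo i) \/ pos (hi i) <= pos j;
  pos_itv : forall j, 0 <= pos j <= L;
  cell_itv : forall i x, 0 <= x <= L -> cell i x ->
    pos (lo i) <= x <= pos (hi i);
  cell_sum : forall x, 0 <= x <= L -> \sum_i (cell i x)%:R = 1 :> R;
  cell_measurable : forall i, measurable [set x | cell i x] }.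

Lemma grid_of_seq (R : realType) (L : R) (l : seq R) :
  0 < L -> 0 \in l -> L \in l -> (forall x, x \in l -> 0 <= x <= L) ->
  exists G : grid L, forall x, x \in l <-> exists j : node G, pos j = x.
Proof.
move=> L0 l0 lL lx; pose s := sort <=%O (undup l).
have sl x : (x \in s) = (x \in l) by rewrite mem_sort mem_undup.
have ss : sorted <%O s by rewrite sort_lt_sorted undup_uniq.
(* There are at least two nodes since [0] and [L] are distinct; [N.+2] nodes bound [N.+1] cells. *)
have [N sN] : exists N, size s = N.+2.
  have : (1 < size s)%N.
    rewrite -[X in (X < _)%N]/(size [:: 0 : R]); have : uniq [:: 0; L].
      by rewrite /= mem_seq1 eq_sym gt_eqF.
    move/uniq_leq_size => /(_ s); apply => x; rewrite sl !inE.
    by move=> /orP[] /eqP ->.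
  by case: (size s) => [|[|N]] // _; exists N.
have s_lt i j : (i < j < N.+2)%N -> s`_i < s`_j.
  move=> /andP[ij jN]; rewrite lt_sorted_ltn_nth// inE sN//.
  exact: ltn_trans ij jN.
have s_le i j : (i <= j < N.+2)%N -> s`_i <= s`_j.
  by move=> /andP[]; rewrite leq_eqVlt => /orP[/eqP->//|ij jN]; apply/ltW/s_lt/andP.
have s_itv i : (i < N.+2)%N -> 0 <= s`_i <= L.
  by move=> iN; apply: lx; rewrite -sl mem_nth// sN.
have s_last : s`_N.+1 = L.
  apply/eqP; rewrite eq_le; have /andP[_ ->] := s_itv N.+1 (ltnSn _).
  have := lL; rewrite -sl => /(nthP 0)[i]; rewrite sN => iN <-.
  by rewrite /=; apply: s_le; rewrite -ltnS iN /=.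
have s_first : s`_0 = 0.
  apply/eqP; rewrite eq_le; have /andP[-> _] := s_itv 0%N isT.
  have := l0; rewrite -sl => /(nthP 0)[i]; rewrite sN => iN si.
  by rewrite andbT -[leRHS]si; apply: s_le; rewrite iN.
pose po (j : 'I_N.+2) := s`_j.
pose lw (i : 'I_N.+1) : 'I_N.+2 := widen_ord (leqnSn _) i.
pose up (i : 'I_N.+1) : 'I_N.+2 := lift ord0 i.
have po_lw i : po (lw i) = s`_i by [].
have po_up i : po (up i) = s`_i.+1 by rewrite /po lift0.
(* Cells are open on the left, to be disjoint, except the first one, which must contain 0; it also
   contains the negative numbers, outside the range considered. *)
pose ce (i : 'I_N.+1) (x : R) :=
  (x <= s`_i.+1) && ((i == ord0) || (s`_i < x)).
have lt_lh i : po (lw i) < po (up i) by rewrite po_lw po_up s_lt// leqnn ltnS /=.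
have gap i (j : 'I_N.+2) : po j <= po (lw i) \/ po (up i) <= po j.
  rewrite po_lw po_up; have [ji|ij] := leqP j i; [left|right]; apply: s_le.
    by rewrite ji ltnW//= ltnS.
  by rewrite ij /=.
have po_itv j : 0 <= po j <= L by apply: s_itv.
have ce_itv i x : 0 <= x <= L -> ce i x -> po (lw i) <= x <= po (up i).
  move=> /andP[x0 _] /andP[x1 x2]; rewrite po_lw po_up x1 andbT.
  by case/orP: x2 => [/eqP ->|/ltW//]; rewrite s_first.
have ce_sum x : 0 <= x <= L -> \sum_i (ce i x)%:R = 1 :> R.
  move=> /andP[x0 xL].
  (* The cell of [x] is the first one whose upper end is at least [x]. *)
  have ex : exists i, (fun i => x <= s`_i.+1) i by exists N; rewrite s_last.
  case: (ex_minnP ex) => i xi imin.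
  have iN : (i < N.+1)%N by rewrite ltnS; apply: imin; rewrite s_last.
  rewrite (bigD1 (Ordinal iN))//= big1 ?addr0.
    rewrite (_ : ce _ _ = true)// /ce/= xi/=.
    case: i imin iN {xi} => [//|i] imin iN; rewrite ltNge; apply/orP; right.
    by apply/negP => /imin; rewrite ltnn.
  move=> k ki; rewrite (_ : ce _ _ = false)//; apply/negP => /andP[xk1 xk2].
  have ik : (i < k)%N.
    by rewrite ltn_neqAle imin// andbT; apply: contraNneq ki => ik; apply/eqP/val_inj.
  case/orP: xk2 => [/eqP k0|]; first by rewrite k0 in ik.
  apply/negP; rewrite -leNgt (le_trans xi)// s_le// ik/=.
  by rewrite ltnS ltnW.
have ce_meas i : measurable [set x | ce i x].
  have [i0|i0] := boolP (i == ord0).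
    rewrite (_ : [set _ | _] = `]-oo, s`_i.+1]%classic)//.
    by apply/seteqP; split => x; rewrite /= /ce i0 andbT in_itv.
  rewrite (_ : [set _ | _] = `]s`_i, s`_i.+1]%classic)//.
  by apply/seteqP; split => x; rewrite /= /ce (negbTE i0)/= in_itv/= andbC.
exists (Grid lt_lh gap po_itv ce_itv ce_sum ce_meas) => x /=; split.
  rewrite -sl => /(nthP 0)[i]; rewrite sN => iN <-.
  by exists (Ordinal iN).
by move=> [j <-]; rewrite -sl mem_nth// sN.
Qed.

(** * Linear interpolation on a grid *)

Section interpolation.
Context (R : realType) (L : R) (G : grid L).
Implicit Types (i : piece G) (j : node G) (x : R) (f : R -> R).

Definition bary i x := (x - pos (lo i)) / (pos (hi i) - pos (lo i)).

(** For [x] in [0, L] this is the probability that the random projection of [x] is the node [j]: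
    inside cell [i] it goes to [hi i] with probability [bary i x] and to [lo i] otherwise. It is the
    hat function of [j] in linear interpolation. *)
Definition hat j x : R :=
  \sum_i (cell i x)%:R *
    ((lo i == j)%:R * (1 - bary i x) + (hi i == j)%:R * bary i x).

Definition cellwise_affine f := forall i x, 0 <= x <= L -> cell i x ->
  f x = (1 - bary i x) * f (pos (lo i)) + bary i x * f (pos (hi i)).

Lemma cell_bary i x : 0 <= x <= L -> cell i x -> 0 <= bary i x <= 1.
Proof.
move=> xL /(cell_itv xL)/andP[x0 x1]; have h := lo_lt_hi i.
rewrite /bary divr_ge0 ?subr_ge0//=; last exact: ltW.
by rewrite ler_pdivrMr ?subr_gt0// mul1r lerD2r.
Qed.

Lemma bary_mean i x :
  (1 - bary i x) * pos (lo i) + bary i x * pos (hi i) = x.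
Proof.
rewrite /bary; have h := lo_lt_hi i; field.
by rewrite subr_eq0 gt_eqF.
Qed.

Lemma hat_ge0 j x : 0 <= x <= L -> 0 <= hat j x.
Proof.
move=> xL; apply: sumr_ge0 => i _; case: (boolP (cell i x)) => [c|_].
  have /andP[b0 b1] := cell_bary xL c.
  by rewrite mul1r addr_ge0// mulr_ge0// subr_ge0.
by rewrite mul0r.
Qed.

Lemma sum_hat (F : node G -> R) x : \sum_j hat j x * F j =
  \sum_i (cell i x)%:R *
    ((1 - bary i x) * F (lo i) + bary i x * F (hi i)).
Proof.
under eq_bigr do rewrite /hat mulr_suml.
rewrite exchange_big/=; apply: eq_bigr => i _.
have pick (k : node G) : \sum_j (k == j)%:R * F j = F k.
  rewrite (bigD1 k)//= eqxx mul1r big1 ?addr0// => j jk.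
  by rewrite eq_sym (negbTE jk) mul0r.
rewrite -(pick (lo i)) -(pick (hi i)) !mulr_sumr -big_split/= mulr_sumr.
by apply: eq_bigr => j _; ring.
Qed.

(** Only the cell containing [x] contributes, and there [f] equals its chord. For [f] constant the
    hats have total mass 1; for the identity the projection keeps the mean. *)
Lemma hat_interpolation f x : 0 <= x <= L -> cellwise_affine f ->
  \sum_j hat j x * f (pos j) = f x.
Proof.
move=> xL fa; rewrite (sum_hat (fun j => f (pos j))).
transitivity (\sum_(i : piece G) (cell i x)%:R * f x); last first.
  by rewrite -mulr_suml cell_sum// mul1r.
apply: eq_bigr => i _.
case: (boolP (cell i x)) => [c|_]; last by rewrite !mul0r.
by rewrite [in RHS](fa i x).
Qed.

Lemma cellwise_affine_itv f :
  (forall i, exists p q, forall x,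
     pos (lo i) <= x <= pos (hi i) -> f x = p * x + q) ->
  cellwise_affine f.
Proof.
move=> fi i x xL c; have [p [q fE]] := fi i.
have h := ltW (lo_lt_hi i).
rewrite !fE ?lexx ?h//; last exact: cell_itv.
by rewrite -[in LHS](bary_mean i x); ring.
Qed.

Lemma cellwise_affine_id : cellwise_affine id.
Proof. by apply: cellwise_affine_itv => i; exists 1, 0 => x _; rewrite /=; ring. Qed.

Lemma cellwise_affine_cst c : cellwise_affine (fun=> c).
Proof. by apply: cellwise_affine_itv => i; exists 0, c => x _; ring. Qed.

Lemma cellwise_affineD f g : cellwise_affine f -> cellwise_affine g ->
  cellwise_affine (fun x => f x + g x).
Proof. by move=> fa ga i x xL c; rewrite (fa i x)// (ga i x)//; ring. Qed.

Lemma cellwise_affineZ c f : cellwise_affine f ->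
  cellwise_affine (fun x => c * f x).
Proof. by move=> fa i x xL ce; rewrite (fa i x)//; ring. Qed.

Lemma cellwise_affine_sum n (f : nat -> R -> R) :
  (forall k, (k < n)%N -> cellwise_affine (f k)) ->
  cellwise_affine (fun x => \sum_(k < n) f k x).
Proof.
elim: n => [|n IH] fa.
  by move=> i x xL c; rewrite !big_ord0 !mulr0 addr0.
move=> i x xL c; rewrite !big_ord_recr/=.
apply: (@cellwise_affineD (fun x => \sum_(k < n) f k x) (f n)) => //.
- by apply: IH => k kn; apply: fa; exact: ltnW.
- exact: fa.
Qed.

Lemma cellwise_affine_eq f g : (forall x, 0 <= x <= L -> f x = g x) ->
  cellwise_affine g -> cellwise_affine f.
Proof.
by move=> fg ga i x xL c; rewrite !fg ?pos_itv//; exact: ga.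
Qed.

(** The kink sits at a node, hence never inside a cell. *)
Lemma cellwise_affine_call_node j :
  cellwise_affine (fun x => pos_part (x - pos j)).
Proof.
apply: cellwise_affine_itv => i; rewrite /pos_part.
have [jl|jh] := pos_gap i j.
  exists 1, (- pos j) => x /andP[x0 _].
  by rewrite mul1r max_l// subr_ge0 (le_trans jl).
exists 0, 0 => x /andP[_ x1]; rewrite max_r ?mul0r ?addr0//.
by rewrite subr_le0 (le_trans x1).
Qed.

(** Such a call vanishes on [0, L]; this handles the strikes that are too large to be nodes. *)
Lemma cellwise_affine_call_ge k : L <= k ->
  cellwise_affine (fun x => pos_part (x - k)).
Proof.
move=> Lk; apply: (@cellwise_affine_eq _ (fun=> 0)).
  move=> x /andP[_ xL]; rewrite /pos_part max_r// subr_le0.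
  exact: le_trans Lk.
exact: cellwise_affine_cst.
Qed.

End interpolation.

(** * Piecewise linear functions as combinations of calls *)

(** Difference quotients are constant near a breakpoint on each side. Hence a breakpoint in [0, L]
    where consecutive slopes differ belongs to [slope_change_pts]. *)
Lemma piecewise_linear_deriv (R : realType) (g : R -> R) (c : seq R)
    (a0 a1 : nat -> R) (i : nat) :
  sorted <%R c ->
  (forall (i : nat) (x : R), (i < size c)%N -> c`_i <= x ->
      ((i.+1 < size c)%N -> x <= c`_i.+1) -> g x = a1 i * x + a0 i) ->
  (i.+1 < size c)%N ->
  left_deriv_is g c`_i.+1 (a1 i) /\ right_deriv_is g c`_i.+1 (a1 i.+1).
Proof.
move=> sc gE ic.
have lt_c k : (k.+1 < size c)%N -> c`_k < c`_k.+1.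
  by move=> kc; rewrite lt_sorted_ltn_nth// inE// ltnW.
have ci := lt_c i ic; split.
  apply: cvg_near_cst; have ci0 : 0 < c`_i.+1 - c`_i by rewrite subr_gt0.
  near=> h.
  have h0 : 0 < h by near: h; exact: nbhs_right_gt.
  have h1 : h <= c`_i.+1 - c`_i by near: h; exact: nbhs_right_ltW.
  rewrite (gE i (_ - h)) ?(gE i c`_i.+1) ?(ltW ci) ?(ltnW ic)//.
  - by field; lra.
  - lra.
  - by move=> _; lra.
apply: cvg_near_cst.
(* [M] is the length of the piece to the right; the last piece is unbounded, and 1 is an arbitrary
   choice there. *)
have [M M0 MP] : exists2 M : R, 0 < M &
    ((i.+2 < size c)%N -> c`_i.+1 + M <= c`_i.+2).
  have [i2|i2] := ltnP i.+2 (size c); last by exists 1.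
  by exists (c`_i.+2 - c`_i.+1); [rewrite subr_gt0 lt_c|lra].
near=> h.
have h0 : 0 < h by near: h; exact: nbhs_right_gt.
have h1 : h <= M by near: h; exact: nbhs_right_ltW.
rewrite (gE i.+1 (_ + h)) ?(gE i.+1 c`_i.+1)//.
- by field; lra.
- by move=> i2; apply/ltW/lt_c.
- lra.
- by move=> /MP; lra.
Unshelve. all: by end_near.
Qed.

(** Adjacent pieces agree at their common breakpoint, so passing to the next piece adds the slope
    jump times the distance beyond the breakpoint. This reduces [g] to calls. *)
Lemma piecewise_linear_calls (R : realType) (g : R -> R) (c : seq R)
    (a0 a1 : nat -> R) (delta := fun i => a1 i.+1 - a1 i) :
  c`_0 = 0 -> sorted <%R c -> (0 < size c)%N ->
  (forall (i : nat) (x : R), (i < size c)%N -> c`_i <= x ->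
      ((i.+1 < size c)%N -> x <= c`_i.+1) -> g x = a1 i * x + a0 i) ->
  forall x, 0 <= x ->
  g x = a1 0%N * x + a0 0%N +
    \sum_(i < (size c).-1) delta i * pos_part (x - c`_i.+1).
Proof.
move=> c0 sc sz gE x x0.
have lt_c k l : (k < l < size c)%N -> c`_k < c`_l.
  move=> /andP[kl lc]; rewrite lt_sorted_ltn_nth// inE//; exact: ltn_trans lc.
have glue k : (k.+1 < size c)%N ->
    a1 k * c`_k.+1 + a0 k = a1 k.+1 * c`_k.+1 + a0 k.+1.
  move=> kc; rewrite -gE ?(ltnW kc)//; last by apply/ltW/lt_c; rewrite leqnn.
  by rewrite -gE// => kc2; apply/ltW/lt_c; rewrite leqnn.
have affE k y : (k < size c)%N -> a1 k * y + a0 k =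
    a1 0%N * y + a0 0%N + \sum_(i < k) delta i * (y - c`_i.+1).
  elim: k => [|k IH] kc; first by rewrite big_ord0 addr0.
  rewrite big_ord_recr/= addrA -IH ?(ltnW kc)// /delta.
  have := glue _ kc; lra.
(* Let [c_m] be the last breakpoint not exceeding [x]: the calls struck up to [c_m] are linear at
   [x], the later ones vanish. *)
have exm : exists m, (m < size c)%N && (c`_m <= x) by exists 0%N; rewrite sz c0.
have bm k : (k < size c)%N && (c`_k <= x) -> (k <= size c)%N.
  by move=> /andP[/ltnW].
case: (ex_maxnP exm bm) => m /andP[mc cmx] mmax.
have xlt k : (m < k < size c)%N -> x < c`_k.
  move=> /andP[mk kc]; rewrite ltNge; apply/negP => ck.
  by have := mmax k; rewrite kc ck leqNgt mk => /(_ isT).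
rewrite (gE m)//; last by move=> m1; apply/ltW/xlt; rewrite leqnn.
rewrite affE//; congr (_ + _).
have mc' : (m <= (size c).-1)%N by rewrite -ltnS prednK.
rewrite (big_ord_widen _ (fun i => delta i * (x - c`_i.+1)) mc').
rewrite big_mkcond/=; apply: eq_bigr => -[i ic] _ /=.
have ic' : (i.+1 < size c)%N by rewrite -(prednK sz) ltnS.
rewrite /pos_part; case: ltnP => im.
  rewrite max_l// subr_ge0 (le_trans _ cmx)//.
  move: im; rewrite leq_eqVlt => /orP[/eqP->//|im].
  by apply/ltW/lt_c; rewrite im.
by rewrite max_r ?mulr0// subr_le0; apply/ltW/xlt; rewrite ltnS im.
Qed.

(** In the expansion into calls, a breakpoint without slope jump has coefficient 0, one beyond [L]
    gives a call vanishing on [0, L], and any other is a slope change, hence a node. *)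
Lemma piecewise_linear_cellwise (R : realType) (L : R) (G : grid L) (g : R -> R)
    (c : seq R) (a0 a1 : nat -> R) :
  c`_0 = 0 -> sorted <%R c -> (0 < size c)%N ->
  (forall (i : nat) (x : R), (i < size c)%N -> c`_i <= x ->
      ((i.+1 < size c)%N -> x <= c`_i.+1) -> g x = a1 i * x + a0 i) ->
  (forall x, x \in c -> slope_change_pts g L x ->
     exists j : node G, pos j = x) ->
  cellwise_affine G g.
Proof.
move=> c0 sc sz gE nodes.
apply: (@cellwise_affine_eq _ _ _ _ (fun x => a1 0%N * x + a0 0%N +
    \sum_(i < (size c).-1) (a1 i.+1 - a1 i) * pos_part (x - c`_i.+1))).
  by move=> x /andP[x0 _]; exact: (piecewise_linear_calls c0 sc sz gE).
apply: cellwise_affineD.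
  apply: cellwise_affineD; last exact: cellwise_affine_cst.
  by apply: cellwise_affineZ; exact: cellwise_affine_id.
apply: (@cellwise_affine_sum _ _ _ _
  (fun i x => (a1 i.+1 - a1 i) * pos_part (x - c`_i.+1))) => i ic.
have ic' : (i.+1 < size c)%N by rewrite -(prednK sz) ltnS.
have [aE|aE] := eqVneq (a1 i.+1) (a1 i).
  rewrite aE subrr; apply: (@cellwise_affine_eq _ _ _ _ (fun=> 0)).
    by move=> x _; rewrite mul0r.
  exact: cellwise_affine_cst.
apply: cellwise_affineZ.
have [cL|Lc] := leP c`_i.+1 L; last by apply: cellwise_affine_call_ge; exact: ltW.
have [j <-] : exists j : node G, pos j = c`_i.+1.
  apply: nodes; first exact: mem_nth.
  have [dl dr] := piecewise_linear_deriv sc gE ic'.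
  split.
    have : c`_0 < c`_i.+1 by rewrite lt_sorted_ltn_nth// inE.
    by rewrite c0 => /ltW ->.
  move=> l1 l2 h1 h2.
  rewrite (cvg_unique _ h1 dl) ?(cvg_unique _ h2 dr)//.
  by apply/eqP; rewrite eq_sym.
exact: cellwise_affine_call_node.
Qed.

(** * Expectations of bounded variables and the one-step coupling *)

Section bounded_expectation.
Context (R : realType) (d : measure_display) (T : measurableType d).
Context (P : probability T R).
Implicit Types f g : T -> R.

Definition bmeasurable f :=
  measurable_fun setT f /\ exists M, forall x, `|f x| <= M.

Local Notation "''E' f" := (Rintegral P setT f) (at level 10, f at level 8).

Lemma bmeasurable_integrable f : bmeasurable f ->
  P.-integrable setT (EFin \o f).
Proof.
move=> [mf [M fM]]; apply: measurable_bounded_integrable => //.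
  exact: (le_lt_trans (probability_le1 P measurableT) (ltry _)).
exists M; split; first exact: num_real.
by move=> N MN x _; rewrite /= (le_trans (fM x))// ltW.
Qed.

Lemma bmeasurable_cst c : bmeasurable (fun=> c).
Proof. by split => //; exists `|c|. Qed.

Lemma bmeasurableD f g : bmeasurable f -> bmeasurable g ->
  bmeasurable (fun x => f x + g x).
Proof.
move=> [mf [M fM]] [mg [N gN]]; split; first exact: measurable_funD.
by exists (M + N) => x; rewrite (le_trans (ler_normD _ _))// lerD.
Qed.

Lemma bmeasurableM f g : bmeasurable f -> bmeasurable g ->
  bmeasurable (fun x => f x * g x).
Proof.
move=> [mf [M fM]] [mg [N gN]]; split; first exact: measurable_funM.
by exists (M * N) => x; rewrite normrM ler_pM.
Qed.

Lemma bmeasurable_sum (I : Type) (r : seq I) (f : I -> T -> R) :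
  (forall i, bmeasurable (f i)) -> bmeasurable (fun x => \sum_(i <- r) f i x).
Proof.
move=> fb; elim: r => [|i r IH].
  by under eq_fun do rewrite big_nil; exact: bmeasurable_cst.
by under eq_fun do rewrite big_cons; exact: bmeasurableD.
Qed.

Lemma expectationD f g : bmeasurable f -> bmeasurable g ->
  'E (fun x => f x + g x) = 'E f + 'E g.
Proof. by move=> bf bg; rewrite RintegralD//; exact: bmeasurable_integrable. Qed.

Lemma expectationZ c f : bmeasurable f -> 'E (fun x => c * f x) = c * 'E f.
Proof. by move=> bf; rewrite RintegralZl//; exact: bmeasurable_integrable. Qed.

Lemma expectation_sum (I : Type) (r : seq I) (f : I -> T -> R) :
  (forall i, bmeasurable (f i)) ->
  'E (fun x => \sum_(i <- r) f i x) = \sum_(i <- r) 'E (f i).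
Proof.
move=> fb; elim: r => [|i r IH].
  rewrite big_nil; under eq_Rintegral do rewrite big_nil.
  by rewrite /Rintegral integral0.
rewrite big_cons -IH -expectationD//; last exact: bmeasurable_sum.
by apply: eq_Rintegral => x _; rewrite big_cons.
Qed.

Lemma expectation_ge0 f : (forall x, 0 <= f x) -> 0 <= 'E f.
Proof. by move=> f0; apply: Rintegral_ge0. Qed.

Lemma EFin_expectation f : bmeasurable f ->
  ('E f)%:E = (\int[P]_x (f x)%:E)%E.
Proof.
by move=> bf; rewrite fineK//; apply: integrable_fin_num => //;
  exact: bmeasurable_integrable.
Qed.

Context (L : R) (G : grid L).

Section on_grid.
Variable Z : T -> R.
Hypotheses (mZ : measurable_fun setT Z) (ZL : forall x, 0 <= Z x <= L).

Lemma bmeasurable_grid : bmeasurable Z.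
Proof.
by split => //; exists L => x; have /andP[z0 zL] := ZL x; rewrite ger0_norm.
Qed.

Lemma bmeasurable_cell (i : piece G) : bmeasurable (fun x => (cell i (Z x))%:R).
Proof.
split; last by exists 1 => x; case: cell; rewrite ?normr0 ?normr1.
rewrite (_ : (fun _ => _) = \1_(Z @^-1` [set x | cell i x])).
  apply: measurable_indic; rewrite -[X in measurable X]setTI.
  by apply: mZ => //; exact: cell_measurable.
apply/funext => x; rewrite indicE (_ : (x \in _) = cell i (Z x))//.
by apply/idP/idP => [/set_mem//|c]; exact: mem_set.
Qed.

Lemma bmeasurable_bary (i : piece G) : bmeasurable (fun x => bary i (Z x)).
Proof.
apply: bmeasurableM; last exact: bmeasurable_cst.
by apply: bmeasurableD; [exact: bmeasurable_grid|exact: bmeasurable_cst].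
Qed.

Lemma bmeasurable_baryC (i : piece G) : bmeasurable (fun x => 1 - bary i (Z x)).
Proof.
under eq_fun do rewrite -mulN1r.
apply: bmeasurableD; first exact: bmeasurable_cst.
by apply: bmeasurableM; [exact: bmeasurable_cst|exact: bmeasurable_bary].
Qed.

Lemma bmeasurable_hat (j : node G) : bmeasurable (fun x => hat j (Z x)).
Proof.
apply: bmeasurable_sum => i; apply: bmeasurableM; first exact: bmeasurable_cell.
apply: bmeasurableD; (apply: bmeasurableM; first exact: bmeasurable_cst).
- exact: bmeasurable_baryC.
- exact: bmeasurable_bary.
Qed.

(** Integrating [hat_interpolation] shows that the projected law, with mass ['E (hat j (Z))] at node
    [j], gives [f] the same expectation as [Z] does. *)
Lemma expectation_cellwise (f : R -> R) : cellwise_affine G f ->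
  (\int[P]_x (f (Z x))%:E)%E =
  (\sum_j 'E (fun x => hat j (Z x)) * f (pos (j : node G)))%:E.
Proof.
move=> fa.
have bj (j : node G) : bmeasurable (fun x => f (pos j) * hat j (Z x)).
  by apply: bmeasurableM; [exact: bmeasurable_cst|exact: bmeasurable_hat].
transitivity (\int[P]_x (\sum_(j : node G) f (pos j) * hat j (Z x))%:E)%E.
  apply: eq_integral => x _; rewrite -(hat_interpolation (ZL x) fa).
  by congr EFin; apply: eq_bigr => j _; rewrite mulrC.
rewrite -EFin_expectation; last exact: bmeasurable_sum.
congr EFin; rewrite expectation_sum//; apply: eq_bigr => j _.
by rewrite (expectationZ _ (bmeasurable_hat j)) mulrC.
Qed.

End on_grid.

(* On the event that [Z] lies in a given cell, the interpolation of [Z] charges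
   the two endpoints only, whereas that of [Z'] charges nodes outside the open
   cell and has the same barycenter; [two_point_split] couples them there. *)
Lemma grid_coupling (Z Z' : T -> R) :
  measurable_fun setT Z -> (forall x, 0 <= Z x <= L) ->
  measurable_fun setT Z' -> (forall x, 0 <= Z' x <= L) ->
  (forall B, measurable B ->
     (\int[P]_(x in Z @^-1` B) (Z' x)%:E = \int[P]_(x in Z @^-1` B) (Z x)%:E)%E) ->
  exists q : node G -> node G -> R,
    [/\ forall j y, 0 <= q j y,
        forall j, \sum_y q j y = 'E (fun x => hat j (Z x)),
        forall j, \sum_y q j y * pos y = 'E (fun x => hat j (Z x)) * pos j &
        forall y, \sum_j q j y = 'E (fun x => hat y (Z' x))].
Proof.
move=> mZ ZL mZ' ZL' mart.
have bZ := bmeasurable_grid mZ ZL.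
have bZ' := bmeasurable_grid mZ' ZL'.
have bcell := bmeasurable_cell mZ.
have bhat' := bmeasurable_hat mZ' ZL'.
(* On the event that [Z] is in cell [i]: [al i] and [be i] are the masses projected to its two ends,
   and [nu i] is the unnormalised law of the projection of [Z']. *)
pose al (i : piece G) := 'E (fun x => (cell i (Z x))%:R * (1 - bary i (Z x))).
pose be (i : piece G) := 'E (fun x => (cell i (Z x))%:R * bary i (Z x)).
pose nu (i : piece G) (y : node G) := 'E (fun x => (cell i (Z x))%:R * hat y (Z' x)).
have b_al (i : piece G) : bmeasurable (fun x => (cell i (Z x))%:R * (1 - bary i (Z x))).
  by apply: bmeasurableM => //; exact: bmeasurable_baryC.
have b_be (i : piece G) : bmeasurable (fun x => (cell i (Z x))%:R * bary i (Z x)).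
  by apply: bmeasurableM => //; exact: bmeasurable_bary.
have b_nu (i : piece G) (y : node G) :
    bmeasurable (fun x => (cell i (Z x))%:R * hat y (Z' x)).
  by apply: bmeasurableM; [exact: bcell|exact: bhat'].
(* The martingale property enters here, on the event that [Z] lies in cell [i]. *)
have cell_mart i : 'E (fun x => (cell (i : piece G) (Z x))%:R * Z' x) =
    'E (fun x => (cell i (Z x))%:R * Z x).
  have restr (W : T -> R) : 'E (fun x => (cell i (Z x))%:R * W x) =
      fine (\int[P]_(x in Z @^-1` [set x | cell i x]) (W x)%:E)%E.
    rewrite -/(Rintegral P _ W) [RHS]Rintegral_mkcond; apply: eq_Rintegral => x _.
    rewrite /= patchE; case: ifPn => [/set_mem /= ->|]; first by rewrite mul1r.
    by move=> /negP nc; case: (boolP (cell i (Z x))) => [c|_];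
      [case: nc; exact: mem_set|rewrite mul0r].
  by rewrite !restr mart//; exact: cell_measurable.
have nu_sum (F : R -> R) i : cellwise_affine G F ->
    \sum_y nu i y * F (pos y) = 'E (fun x => (cell i (Z x))%:R * F (Z' x)).
  move=> Fa; transitivity (\sum_y 'E (fun x =>
      F (pos y) * ((cell i (Z x))%:R * hat (y : node G) (Z' x)))).
    by apply: eq_bigr => y _; rewrite expectationZ// mulrC.
  rewrite -expectation_sum; last first.
    by move=> y; apply: bmeasurableM => //; exact: bmeasurable_cst.
  apply: eq_Rintegral => x _; rewrite -(hat_interpolation (ZL' x) Fa) mulr_sumr.
  by apply: eq_bigr => y _; ring.
have /choice[r rP] : forall i : piece G, exists r : (node G -> R) * (node G -> R),
    [/\ forall y, 0 <= r.1 y, forall y, 0 <= r.2 y,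
        forall y, r.1 y + r.2 y = nu i y,
        \sum_y r.1 y = al i /\ \sum_y r.1 y * pos y = al i * pos (lo i) &
        \sum_y r.2 y = be i /\ \sum_y r.2 y * pos y = be i * pos (hi i)].
  move=> i.
  have [] := @two_point_split _ _ (@pos _ _ G) (nu i) (pos (lo i)) (pos (hi i))
    (al i) (be i) (lo_lt_hi i) (pos_gap i).
  - move=> y; apply: expectation_ge0 => x.
    by rewrite mulr_ge0// hat_ge0.
  - apply: expectation_ge0 => x; case: (boolP (cell i (Z x))) => [c|_].
      by have /andP[_ b1] := cell_bary (ZL x) c; rewrite mul1r subr_ge0.
    by rewrite mul0r.
  - apply: expectation_ge0 => x; case: (boolP (cell i (Z x))) => [c|_].
      by have /andP[b0 _] := cell_bary (ZL x) c; rewrite mul1r.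
    by rewrite mul0r.
  - under eq_bigr do rewrite -[nu i _]mulr1.
    rewrite (nu_sum (fun=> 1)); last exact: cellwise_affine_cst.
    by rewrite -expectationD//; apply: eq_Rintegral => x _; ring.
  - rewrite (nu_sum id); last exact: cellwise_affine_id.
    rewrite cell_mart ![_ * pos _]mulrC -!expectationZ// -expectationD//.
    + apply: eq_Rintegral => x _; rewrite -[X in _ * X = _](bary_mean i (Z x)).
      by ring.
    + by apply: bmeasurableM => //; exact: bmeasurable_cst.
    + by apply: bmeasurableM => //; exact: bmeasurable_cst.
  - by move=> r0 [r1 rP]; exists (r0, r1).
have hatE j : 'E (fun x => hat (j : node G) (Z x)) =
    \sum_i ((lo i == j)%:R * al i + (hi i == j)%:R * be i).
  rewrite /hat expectation_sum.
    apply: eq_bigr => i _; rewrite -!expectationZ// -expectationD.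
    + by apply: eq_Rintegral => x _; ring.
    + by apply: bmeasurableM => //; exact: bmeasurable_cst.
    + by apply: bmeasurableM => //; exact: bmeasurable_cst.
  move=> i; apply: bmeasurableM => //.
  apply: bmeasurableD; (apply: bmeasurableM; first exact: bmeasurable_cst).
  - exact: bmeasurable_baryC.
  - exact: bmeasurable_bary.
(* Node [j] collects the lower part of each cell starting at [j] and the upper part of each cell
   ending at [j]. *)
exists (fun j y => \sum_i ((lo i == j)%:R * (r i).1 y + (hi i == j)%:R * (r i).2 y)).
split.
- move=> j y; apply: sumr_ge0 => i _; have [r0 r1 _ _ _] := rP i.
  by rewrite addr_ge0// mulr_ge0.
- move=> j; rewrite hatE exchange_big; apply: eq_bigr => i _ /=.
  have [_ _ _ [s1 _] [s2 _]] := rP i.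
  by rewrite big_split/= -!mulr_sumr s1 s2.
- move=> j; rewrite hatE mulr_suml.
  under eq_bigr do rewrite mulr_suml.
  rewrite exchange_big; apply: eq_bigr => i _ /=.
  have [_ _ _ [_ s1] [_ s2]] := rP i.
  transitivity ((lo i == j)%:R * (al i * pos (lo i)) +
                (hi i == j)%:R * (be i * pos (hi i))).
    rewrite -s1 -s2 !mulr_sumr -big_split; apply: eq_bigr => y _ /=; ring.
  have at_j (k : node G) (a : R) :
      (k == j)%:R * (a * pos k) = (k == j)%:R * a * pos j.
    by case: eqP => [->|_]; rewrite ?mul0r// mulrA.
  by rewrite !at_j mulrDl.
(* Second marginal: the two parts of cell [i] add up to [nu i], and the cells partition the values
   of [Z]. *)
- move=> y; rewrite exchange_big /=.
  have -> : 'E (fun x => hat y (Z' x)) = \sum_i nu i y.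
    rewrite -expectation_sum//; apply: eq_Rintegral => x _.
    by rewrite -mulr_suml cell_sum// mul1r.
  apply: eq_bigr => i _; have [_ _ <- _ _] := rP i.
  have pick (k : node G) : \sum_j (k == j)%:R = 1 :> R.
    rewrite (bigD1 k)//= eqxx big1 ?addr0// => j jk.
    by rewrite eq_sym (negbTE jk).
  by rewrite big_split/= -!mulr_suml !pick !mul1r.
Qed.

End bounded_expectation.

(** * The martingale on the grid *)

(** The one-step couplings share their marginals [m t], so they chain into a path space. Only
    conditional means given the present value enter, because the constructed chain forgets its
    past. *)
Lemma grid_martingale (R : realType) (L : R) (G : grid L)
    (d : measure_display) (T : measurableType d) (P : probability T R)
    (Z : nat -> T -> R) (N : nat) :
  0 < L -> (0 < N)%N ->
  (forall t, measurable_fun setT (Z t)) -> (forall t x, 0 <= Z t x <= L) ->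
  (forall t, (0 < t < N)%N -> forall B, measurable B ->
     (\int[P]_(x in Z t @^-1` B) (Z t.+1 x)%:E =
      \int[P]_(x in Z t @^-1` B) (Z t x)%:E)%E) ->
  exists (P' : probability nat R) (Y : nat -> nat -> R),
    [/\ is_martingale P' Y N,
        forall t n, exists j : node G, Y t n = pos j &
        forall t, (0 < t <= N)%N -> forall f : R -> R,
          (forall x, 0 <= x <= L -> 0 <= f x) -> cellwise_affine G f ->
          (\int[P]_x (f (Z t x))%:E = \int[P']_x (f (Y t x))%:E)%E].
Proof.
move=> L0 N0 mZ ZL mart.
have [j0 _] : exists j : node G, True.
  case: (pickP (fun _ : piece G => true)) => [i _|np]; first by exists (lo i).
  have /eqP : \sum_(i : piece G) (cell i 0)%:R = 1 :> R.
    by apply: cell_sum; rewrite lexx ltW.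
  by rewrite big_pred0// eq_sym oner_eq0.
pose m t (j : node G) : R := Rintegral P setT (fun x => hat j (Z t x)).
have /choice[q qP] : forall t, exists q : node G -> node G -> R,
    (forall j y, 0 <= q j y) /\ ((0 < t < N)%N ->
    [/\ forall j, \sum_y q j y = m t j,
        forall j, \sum_y q j y * pos y = m t j * pos j &
        forall y, \sum_j q j y = m t.+1 y]).
  (* [choice] asks for a kernel at every [t]; outside the time range zero serves. *)
  move=> t; have [tN|tN] := boolP (0 < t < N)%N; last by exists (fun _ _ => 0).
  have [q [q0 q1 q2 q3]] := grid_coupling G (mZ t) (ZL t) (mZ t.+1) (ZL t.+1) (mart t tN).
  by exists q; split.
have m0 t j : 0 <= m t j by apply: expectation_ge0 => x; exact: hat_ge0.
have NN : (N.-1 < N)%N by rewrite prednK.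
have [I [w [y [w0 wm wA]]]] := finite_martingale_chain j0 m0
  (fun t => (qP t).1)
  (fun t tN => let: And3 a _ _ := (qP t).2 tN in a)
  (fun t tN => let: And3 _ a _ := (qP t).2 tN in a)
  (fun t tN => let: And3 _ _ a := (qP t).2 tN in a) NN.
rewrite prednK// in wm wA.
have wE t (f : R -> R) : (0 < t <= N)%N -> cellwise_affine G f ->
    (\int[P]_x (f (Z t x))%:E)%E = (\sum_i w i * f (pos (y t i)))%:E.
  move=> tN fa; rewrite (expectation_cellwise P (mZ t) (ZL t) fa).
  by rewrite (wm t tN (fun j => f (pos j))).
have w1 : \sum_i w i = 1.
  have := wE 1%N (fun=> 1) N0 (cellwise_affine_cst (1 : R)).
  rewrite integral_cst// mul1e => PT.
  have [->] := etrans (esym (probability_setT P)) PT.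
  by apply: eq_bigr => i _; rewrite mulr1.
(* Integers beyond [#|I|] carry no mass; the default [j0] keeps [Y] on the grid there too. *)
pose node_at t n : node G :=
  if insub n is Some k then y t (enum_val (k : 'I_#|I|)) else j0.
have node_atE t i : node_at t (enum_rank i) = y t i.
  by rewrite /node_at valK enum_rankK.
pose Y t n := pos (node_at t n).
exists (finite_probability w0 w1), Y; split; last 2 first.
- by move=> t n; exists (node_at t n).
- move=> t tN f f0 fa; rewrite wE//.
  rewrite (@integral_finite_prob _ _ _ w0 setT (fun n => f (Y t n))).
    congr EFin; apply: eq_bigr => i _.
    by rewrite mem_set// mulr1 /Y node_atE.
  by move=> n; apply: f0; exact: pos_itv.
have Y0 t n : 0 <= Y t n by case/andP: (pos_itv (node_at t n)).
split.
  move=> t _; split=> //; apply: bmeasurable_integrable; split => //.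
  by exists L => n; rewrite ger0_norm//; case/andP: (pos_itv (node_at t n)).
move=> t t0 tN A FA.
rewrite (@integral_finite_prob _ _ _ w0 A (Y t.+1))//.
rewrite (@integral_finite_prob _ _ _ w0 A (Y t))//; congr EFin.
have := wA t _ (fun i => ((enum_rank i : nat) \in A)%:R).
rewrite t0 tN => /(_ isT) h.
transitivity (\sum_i ((enum_rank i : nat) \in A)%:R * w i * pos (y t.+1 i)).
  by apply: eq_bigr => i _; rewrite /Y node_atE [w i * _]mulrC.
rewrite h; last first.
  move=> i i' yy; congr (_%:R).
  (* An event of the past cannot separate two paths that agree up to [t], so its indicator is
     admissible in [wA]. *)
  have sub (k l : I) : (forall s, (0 < s <= t)%N -> y s k = y s l) ->
      (enum_rank k : nat) \in A -> (enum_rank l : nat) \in A.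
    move=> kl /set_mem Ak; apply: mem_set.
    apply: (nat_filtration_sub FA) Ak => s st.
    by rewrite /Y !node_atE kl.
  congr nat_of_bool; apply/idP/idP; apply: sub => // s st.
  by rewrite yy.
by apply: eq_bigr => i _; rewrite /Y node_atE [in RHS](mulrC (w i)).
Qed.

(** * Truncation to [0, L] and conclusion *)

Section clamp.
Context (R : realType) (L : R).

(** Turns the almost sure bound on [X t] into one that holds everywhere, as interpolation on the
    grid requires. *)
Definition clamp (x : R) := Num.max 0 (Num.min L x).

Lemma clamp_itv x : 0 <= L -> 0 <= clamp x <= L.
Proof. by move=> L0; rewrite /clamp le_max lexx ge_max L0 ge_min lexx. Qed.

Lemma clamp_id x : 0 <= x <= L -> clamp x = x.
Proof. by move=> /andP[x0 xL]; rewrite /clamp min_r// max_r. Qed.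

Lemma measurable_clamp : measurable_fun setT clamp.
Proof.
apply: (@measurable_maxr _ _ _ _ (cst 0) (fun x => Num.min L x)) => //.
exact: (@measurable_minr _ _ _ _ (cst L) id).
Qed.

End clamp.

Theorem theorem5 (R : realType) (g : R -> R) (n : nat) (U : nat -> nat)
  (k C : nat -> nat -> R) (tstar : nat) (L : R)
  (d : measure_display) (T : measurableType d) (P : probability T R)
  (X : nat -> T -> R) :
  {within `[0, +oo[, continuous g} ->
  piecewise_linear_Rplus g ->
  (forall x, 0 <= x -> 0 <= g x) ->
  (forall t j, (1 <= t <= n)%N -> (1 <= j <= U t)%N ->
     0 <= k t j /\ 0 <= C t j) ->
  (1 <= tstar <= n)%N ->
  0 < L ->
  is_martingale P X tstar ->
  is_markov P X tstar ->
  (forall t, (1 <= t <= tstar)%N -> P (X t @^-1` `[0, L]) = 1%E) ->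
  exists (d' : measure_display) (T' : measurableType d')
         (P' : probability T' R) (Y : nat -> T' -> R),
    is_martingale P' Y tstar /\
    (forall t, (1 <= t <= tstar)%N ->
       P' (Y t @^-1` K_set n U k C tstar L g) = 1%E) /\
    (forall t j, (1 <= t <= tstar)%N -> (1 <= j <= U t)%N ->
       (\int[P]_w (pos_part (X t w - k t j))%:E
        = \int[P']_w (pos_part (Y t w - k t j))%:E)%E) /\
    (forall t j, in_F n U k C tstar t j ->
       (\int[P]_w (pos_part (X tstar w - k t j))%:E
        = \int[P']_w (pos_part (Y tstar w - k t j))%:E)%E) /\
    (\int[P]_w (g (X tstar w))%:E = \int[P']_w (g (Y tstar w))%:E)%E.
Proof.
move=> _ [c [a0 [a1 [sz [c0 [sc gE]]]]]] g0 kC /andP[t0 tn] L0 [Xint Xmart] _ XL.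
pose K := K_set n U k C tstar L g.
(* A finite list containing all breakpoints and strikes. The ranges start at 0, so spurious indices
   occur, but [l] keeps only elements of [K]. *)
pose cand := c ++ [seq k t j | t <- iota 0 n.+1, j <- iota 0 (U t).+1].
pose l := [:: 0, L & [seq x <- cand | (0 <= x <= L) && `[< K x >]]].
have lK x : x \in l -> K x.
  rewrite !inE mem_filter => /or3P[/eqP->|/eqP->|/andP[/andP[_ /asboolP//] _]].
    by left.
  by right; left.
have l_itv x : x \in l -> 0 <= x <= L.
  rewrite !inE mem_filter => /or3P[/eqP->|/eqP->|/andP[/andP[-> ]]]//.
    by rewrite lexx ltW.
  by rewrite lexx ltW.
have l0 : 0 \in l by rewrite !inE eqxx.
have lL : L \in l by rewrite !inE eqxx orbT.
have [G nodes] := grid_of_seq L0 l0 lL l_itv.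
have call_affine t j : (1 <= t <= n)%N -> (1 <= j <= U t)%N -> K (k t j) ->
    cellwise_affine G (fun x => pos_part (x - k t j)).
  move=> tn' jU Kk; have [k0 _] := kC t j tn' jU.
  have [kL|Lk] := leP (k t j) L; last by apply: cellwise_affine_call_ge; exact: ltW.
  have [|y <-] := (nodes (k t j)).1; last exact: cellwise_affine_call_node.
  rewrite !inE mem_filter k0 kL (asboolT Kk) mem_cat.
  apply/or3P/Or33/orP; right; apply/allpairsPdep; exists t, j; split => //.
    by rewrite mem_iota; case/andP: tn'.
  by rewrite mem_iota; case/andP: jU.
have g_affine : cellwise_affine G g.
  apply: (piecewise_linear_cellwise c0 sc sz gE) => x xc xg.
  apply/nodes; rewrite !inE mem_filter mem_cat xc andbT.
  have [xL _] := xg; rewrite xL asboolT ?orbT//.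
  by do 4 right.
(* The value 0 outside the time range makes [Z t] measurable with values in [0, L] for every [t]. *)
pose Z t x := if (1 <= t <= tstar)%N then clamp L (X t x) else 0.
have ZE t x : (1 <= t <= tstar)%N -> Z t x = clamp L (X t x) by rewrite /Z => ->.
have mX t : (1 <= t <= tstar)%N -> measurable_fun setT (X t).
  by move=> /Xint[].
have mXL t : (1 <= t <= tstar)%N -> measurable (X t @^-1` `[0, L]).
  by move=> tt; rewrite -[X in measurable X]setTI; exact: mX.
have nXL t : (1 <= t <= tstar)%N -> P (~` (X t @^-1` `[0, L])) = 0%E.
  by move=> tt; rewrite probability_setC ?XL ?subee//; exact: mXL.
have mZ t : measurable_fun setT (Z t).
  have [tt|/negbTE tt] := boolP (1 <= t <= tstar)%N; last first.
    by rewrite /Z tt; exact: measurable_cst.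
  rewrite /Z tt; apply: measurableT_comp; first exact: measurable_clamp.
  exact: mX.
have ZL t x : 0 <= Z t x <= L.
  by rewrite /Z; case: ifP => _; [apply: clamp_itv; exact: ltW|rewrite lexx ltW].
have ZX t x : (1 <= t <= tstar)%N -> (X t @^-1` `[0, L]) x -> Z t x = X t x.
  by move=> tt; rewrite /= in_itv/= => xx; rewrite ZE// clamp_id.
have ZXint t (D : set T) : (1 <= t <= tstar)%N -> measurable D ->
    (\int[P]_(x in D) (Z t x)%:E = \int[P]_(x in D) (X t x)%:E)%E.
  move=> tt mD; apply: ae_eq_integral => //.
  - apply/measurable_EFinP; exact: (measurable_funS measurableT).
  - apply/measurable_EFinP; apply: (measurable_funS measurableT) => //; exact: mX.
  exists (~` (X t @^-1` `[0, L])); split; [|exact: nXL|].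
    by apply: measurableC; exact: mXL.
  by move=> x; apply: contra_not => xx _; rewrite ZX.
have Zmart t : (0 < t < tstar)%N -> forall B, measurable B ->
    (\int[P]_(x in Z t @^-1` B) (Z t.+1 x)%:E =
     \int[P]_(x in Z t @^-1` B) (Z t x)%:E)%E.
  move=> /andP[t1 t2] B mB.
  have tt : (1 <= t <= tstar)%N by rewrite t1 ltnW.
  have mD : measurable (Z t @^-1` B) by rewrite -[X in measurable X]setTI; exact: mZ.
  rewrite !ZXint//; apply: Xmart => //.
  (* An event on [Z t] is an event on [X t], through the preimage under [clamp]. *)
  apply: sub_sigma_algebra; exists t; split; first by rewrite t1 leqnn.
  exists (clamp L @^-1` B).
    by rewrite -[X in measurable X]setTI; exact: measurable_clamp.
  by rewrite setTI; apply/seteqP; split => x; rewrite /preimage/= ZE.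
have [P' [Y [Ymart Ynode YE]]] := grid_martingale G L0 t0 mZ ZL Zmart.
(* All three families of identities are instances of this one: pass from [X] to [Z] almost surely,
   then from [Z] to [Y] on the grid. *)
have intE (f : R -> R) t : (1 <= t <= tstar)%N ->
    (forall x, 0 <= x <= L -> 0 <= f x) -> cellwise_affine G f ->
    (\int[P]_w (f (X t w))%:E = \int[P']_w (f (Y t w))%:E)%E.
  move=> tt f0 fa; rewrite -YE//.
  by apply: (integral_full (mXL t tt) (nXL t tt)) => x xx; rewrite ZX.
have pos_part_ge0 (x : R) : 0 <= pos_part x by rewrite /pos_part le_max lexx orbT.
exists default_measure_display, nat, P', Y; split => //; split; [|split; [|split]].
- move=> t tt; rewrite (_ : _ @^-1` _ = setT) ?probability_setT//.
  apply/seteqP; split => // w _; have [j Yj] := Ynode t w.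
  by apply: lK; apply/nodes; exists j.
- move=> t j tt jU.
  apply: (intE (fun x => pos_part (x - k t j))) => //; apply: call_affine => //.
    by case/andP: tt => -> /leq_trans ->.
  by do 2 right; left; exists t, j.
- move=> t j tjF; have [/andP[t1 t2] [jU _]] := tjF.
  apply: (intE (fun x => pos_part (x - k t j))) => //; first by rewrite t0 leqnn.
  apply: call_affine => //; first by rewrite t2 (leq_trans t0 (ltnW t1)).
  by do 3 right; left; exists t, j.
- apply: intE => //; first by rewrite t0 leqnn.
  by move=> x /andP[x0 _]; exact: g0.
Qed.
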